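(* Let $\mathbb T\subset\mathbb R^2$ be the open triangle with vertices $(0,0),(1,0),(0,1)$, let $\rho=(\rho_1,\rho_2)\in\mathbb T$, and let $\pi_\rho$ be the translation-invariant ergodic Gibbs measure on lozenge tilings of the plane with lozenge densities $\rho_1,\rho_2,1-\rho_1-\rho_2$ (see context). Write $X=X(0,0)$ and let $b=b^{(0,0)}$ be the associated particle, with vertical position $n(b)$, extremal positions $n^-(b),n^+(b)$ and set of available positions $I(b)$. Then $$\frac1{12}\,\pi_{\rho}\left[(|I(b)|+1)\,1_{X}\,1_{\{n(b)\ne 0\}}\right]=\frac12\,\pi_\rho\left[(n^+(b)+1)\,1_{X}\,1_{\{n(b)<0\}}\right],$$ where $\pi_\rho[\cdot]$ denotes expectation and both integrands are understood to be $0$ outside the event $X$.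
   Context: Lattice and tilings. Let $\mathcal T$ be the triangular lattice, with vertices labelled by coordinates $u=(u_1,u_2)\in\mathbb Z^2$ with respect to the basis $e_1,e_2$, where $e_1$ points in direction $e^{-5i\pi/6}$ and $e_2$ in direction $e^{-i\pi/6}$ (equal lengths, normalized to lattice spacing). Edges of $\mathcal T$ join $u$ to $u\pm(1,0)$, $u\pm(0,1)$, $u\pm(1,1)$; the vector $e_1+e_2$ points vertically downward. A lozenge is the union of two triangular faces of $\mathcal T$ sharing an edge (the edge ''crossed'' by the lozenge). A lozenge has type $1$, $2$ or $3$ if the edge it crosses is parallel to $e_1$, $e_2$, or $e_1+e_2$ respectively (type 1 = north-west, type 2 = north-east, type 3 = horizontal). A lozenge tiling of the plane is a partition of the set of triangular faces of $\mathcal T$ into lozenges. Gibbs measures. For $\rho=(\rho_1,\rho_2)\in\mathbb T$, $\pi_\rho$ is the unique probability measure on lozenge tilings of the plane which is invariant and ergodic with respect to translations of $\mathcal T$, is Gibbs (conditionally on the tiling outside a finite region, the tiling inside is uniform among those compatible with the outside), and for which the density of lozenges of type $i$ is $\rho_i$, $i=1,2,3$, with $\rho_3:=1-\rho_1-\rho_2$. Particles. Horizontal (type 3) lozenges are called particles. A particle $b$ whose upper corner has coordinates $(u_1,u_2)$ (i.e. $b$ crosses the edge from $(u_1,u_2)$ to $(u_1+1,u_2+1)$) has vertical position $n(b)=(u_1+u_2)/2$ and column coordinate $c(b)=u_1-u_2$. A tiling with at least one particle in each column is uniquely determined by its particle positions. Given a tiling and a particle $b$, $n^+(b)$ (resp.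 $n^-(b)$) is the largest (resp. smallest) vertical position that $b$ can take in the same column in a lozenge tiling in which all other particles have the same positions as in the given tiling; $I(b)=\{n^-(b),n^-(b)+1,\dots,n^+(b)\}$, so $|I(b)|=n^+(b)-n^-(b)+1$. The event $X(u)$. For a vertex $u=(u_1,u_2)$, $X(u)$ is the event that there exists a particle $b^{(u)}$ (necessarily unique) with column coordinate $u_1-u_2$ such that $n^-(b^{(u)})\le (u_1+u_2)/2\le n^+(b^{(u)})$. Equivalently, $X(u)$ is the event that the edge from $u$ to $u+(1,1)$ is either the common side of two lozenges, one of type 1 and one of type 2, or is crossed by a lozenge of type 3 (in which case $n(b^{(u)})=(u_1+u_2)/2$). *)

(* Defs.v *)
From HB Require Import structures.
From mathcomp Require Import all_boot all_order all_algebra.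
From mathcomp Require Import finmap.
From mathcomp Require Import all_classical all_reals all_analysis.
From mathcomp Require Import ring lra zify.

Set Implicit Arguments.
Unset Strict Implicit.
Unset Printing Implicit Defensive.

Import Order.TTheory GRing.Theory Num.Theory.
Import numFieldNormedType.Exports.

Local Open Scope classical_set_scope.
Local Open Scope ring_scope.

(* The triangular lattice, in the (non-orthogonal) basis e1, e2. In the usual
   planar embedding e1 points down-left, e2 down-right and e1 + e2 straight
   down. *)
Definition vertex : Type := (int * int)%type.

Definition e1 : vertex := (1, 0).
Definition e2 : vertex := (0, 1).

Inductive lozenge_type := type1 | type2 | type3.

Definition edge_dir (k : lozenge_type) : vertex :=
  match k with type1 => e1 | type2 => e2 | type3 => e1 + e2 end.

(* The pair (u, k) stands both for the edge from u to u + edge_dir k and for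
   the lozenge of type k that crosses this edge. *)
Definition lozenge : Type := (vertex * lozenge_type)%type.

Definition edge_ends (l : lozenge) : set vertex :=
  [set l.1; l.1 + edge_dir l.2].

(* (u, true) and (u, false) are the triangles to the left and to the right of
   the vertical edge from u to u + e1 + e2. *)
Definition face : Type := (vertex * bool)%type.

Definition face_vertices (f : face) : set vertex :=
  [set v | [\/ v = f.1, v = f.1 + (if f.2 then e1 else e2)
             | v = f.1 + (e1 + e2)]].

Definition lozenge_faces (l : lozenge) : set face :=
  [set f | edge_ends l `<=` face_vertices f].

Lemma vertexP (u v : vertex) : u = v <-> u.1 = v.1 /\ u.2 = v.2.
Proof. by case: u v => [a b] [c d] /=; split=> [[-> ->]|[-> ->]]. Qed.

Lemma vertexD (u v : vertex) : u + v = (u.1 + v.1, u.2 + v.2).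
Proof. by []. Qed.

Lemma vertexN (u : vertex) : - u = (- u.1, - u.2).
Proof. by []. Qed.

Lemma lozenge_facesE (u : vertex) (k : lozenge_type) :
  lozenge_faces (u, k) =
  match k with
  | type1 => [set (u, true); (u - e2, false)]
  | type2 => [set (u, false); (u - e1, true)]
  | type3 => [set (u, true); (u, false)]
  end.
Proof.
have key (f : face) : lozenge_faces (u, k) f <->
    face_vertices f u /\ face_vertices f (u + edge_dir k).
  split=> [H|[H1 H2] v [->|->]] //.
  by split; apply: H; [left|right].
have fE (f : face) (v : vertex) (s : bool) :
    v = f.1 -> s = f.2 -> f = (v, s) by case: f => /= ? ? -> ->.
apply/seteqP; split=> f.
{ move=> /key[]; rewrite /face_vertices /=.
  move: (fE f); case: f {fE key} => [[a b] s]; case: u => [x y] /= fE.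
  case: k; case: s fE => fE.
  all: case=> /vertexP; rewrite ?vertexD /= => -[] H1 H2.
  all: case=> /vertexP; rewrite ?vertexD /= => -[] H3 H4.
  all: try (exfalso; lia).
  all: try (left; apply: fE => //; apply/vertexP;
            rewrite ?vertexD ?vertexN /=; lia).
  all: by right; apply: fE => //; apply/vertexP;
          rewrite ?vertexD ?vertexN /=; lia.
} move=> H; apply/key; rewrite /face_vertices; case: k H {key fE} => /= -[] -> {f} /=.
all: split.
all: try (by apply: Or31; apply/vertexP; rewrite ?vertexD ?vertexN /=; lia).
all: try (by apply: Or32; apply/vertexP; rewrite ?vertexD ?vertexN /=; lia).
all: by apply: Or33; apply/vertexP; rewrite ?vertexD ?vertexN /=; lia.
Qed.

Record tiling := Tiling {
  lozenges :> set lozenge;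
  tilingP : partition lozenges lozenge_faces [set: face] }.

Lemma tiling_eq (s t : tiling) : lozenges s = lozenges t -> s = t.
Proof.
case: s t => [s sP] [t tP] /= st; rewrite st in sP *.
by congr Tiling; exact: Prop_irrelevance.
Qed.

Lemma hz_tiling_subproof :
  partition [set l : lozenge | l.2 = type3] lozenge_faces [set: face].
Proof.
split.
- apply/seteqP; split=> // -[u s] _; exists (u, type3) => //.
  by rewrite lozenge_facesE; case: s; [left|right].
- move=> [u k] [v k'] /= -> -> [f []]; rewrite !lozenge_facesE.
  by move=> [] -> [] [->].
- move=> [u k] /= ->; exists (u, true); rewrite lozenge_facesE; by left.
Qed.

Definition hz_tiling : tiling := Tiling hz_tiling_subproof.

HB.instance Definition _ := gen_eqMixin tiling.
HB.instance Definition _ := gen_choiceMixin tiling.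
HB.instance Definition _ := isPointed.Build tiling hz_tiling.

(* The product sigma-algebra on tilings: the one generated by the events
   "the lozenge l is present". *)
Definition cylinders (D : set lozenge) : set (set tiling) :=
  [set [set t : tiling | lozenges t l] | l in D].

Notation tilingM := (g_sigma_algebraType (cylinders [set: lozenge])).

Lemma translate_subproof (v : vertex) (t : tiling) :
  partition [set l : lozenge | lozenges t (l.1 - v, l.2)]
    lozenge_faces [set: face].
Proof.
have sh (l : lozenge) (f : face) :
    lozenge_faces l f = lozenge_faces (l.1 - v, l.2) (f.1 - v, f.2).
  have fv (g : face) (w : vertex) :
      face_vertices g w <-> face_vertices (g.1 - v, g.2) (w - v).
    split=> -[] /vertexP H; [apply: Or31|apply: Or32|apply: Or33
      |apply: Or31|apply: Or32|apply: Or33]; apply/vertexP; move: H;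
      case: g.2; rewrite ?(vertexD, vertexN) /=; lia.
  apply/propext; split=> H w [] ->; rewrite /= 1?addrAC.
  - by apply/(fv f)/H; left.
  - by apply/(fv f)/H; right.
  - by apply/fv/H; left.
  - by apply/fv; rewrite addrAC; apply/H; right.
have [cov triv ne0] := tilingP t; split.
- apply/seteqP; split=> // f _.
  have : cover (lozenges t) lozenge_faces (f.1 - v, f.2) by rewrite cov.
  move=> [l tl lf]; exists (l.1 + v, l.2).
    by rewrite /= addrK -surjective_pairing.
  by rewrite sh /= addrK -surjective_pairing.
- move=> l l' tl tl' [f [lf l'f]].
  have : (l.1 - v, l.2) = (l'.1 - v, l'.2).
    by apply: triv => //; exists (f.1 - v, f.2); split; rewrite -sh.
  move=> E; rewrite (surjective_pairing l) (surjective_pairing l').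
  have E1 : l.1 - v = l'.1 - v := congr1 fst E.
  have E2 : l.2 = l'.2 := congr1 snd E.
  by rewrite (addIr _ E1) E2.
- move=> l tl; have [f lf] := ne0 _ tl; exists (f.1 + v, f.2).
  by rewrite sh /= addrK -surjective_pairing.
Qed.

Definition translate (v : vertex) (t : tiling) : tiling :=
  Tiling (translate_subproof v t).

Section Measures.
Variables (R : realType) (P : probability tilingM R).

Definition translation_invariant : Prop :=
  forall (v : vertex) (A : set tilingM), measurable A ->
    P (translate v @^-1` A) = P A.

Definition translation_ergodic : Prop :=
  forall A : set tilingM, measurable A ->
    (forall v : vertex, translate v @^-1` A = A) ->
    P A = 0%E \/ P A = 1%E.

Definition inside (D : set face) : set lozenge :=
  [set l | lozenge_faces l `<=` D].

Definition compatible (D : set face) (t : tiling) : set tiling :=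
  [set t' : tiling | lozenges t' `\` inside D = lozenges t `\` inside D].

(* The uniform probability on [compatible D t], which is finite for finite D
   and contains t. *)
Definition uniform_compatible (D : set face) (t : tiling) (A : set tiling) : R :=
  #|` fset_set (compatible D t `&` A)|%:R / #|` fset_set (compatible D t)|%:R.

(* t |-> uniform_compatible D t A is a version of the conditional probability
   of A given the lozenges that are not inside D. *)
Definition gibbs : Prop :=
  forall (D : set face), finite_set D ->
  forall A : set tilingM, measurable A ->
  forall B : set tilingM, <<s cylinders (~` inside D) >> B ->
    P (A `&` B) = (\int[P]_(t in B) (uniform_compatible D t A)%:E)%E.

(* For a translation-invariant measure the density of lozenges of a given type
   (their mean number per vertex, i.e. per pair of faces) is the probability
   that a given edge of the corresponding direction is crossed. *)
Definition lozenge_density (k : lozenge_type) : \bar R :=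
  P [set t : tiling | lozenges t (0, k)].

Definition ergodic_gibbs_measure (rho1 rho2 : R) : Prop :=
  [/\ translation_invariant, translation_ergodic, gibbs &
      [/\ lozenge_density type1 = rho1%:E, lozenge_density type2 = rho2%:E
        & lozenge_density type3 = (1 - rho1 - rho2)%:E]].

End Measures.

(* A particle is represented by its upper corner. *)
Definition particles (t : tiling) : set vertex :=
  [set b | lozenges t (b, type3)].

Definition column (u : vertex) : int := u.1 - u.2.

Section Particles.
Variable R : realType.

Definition vpos (u : vertex) : R := (u.1 + u.2)%:~R / 2.

Definition reachable (t : tiling) (b : vertex) : set R :=
  [set vpos b' | b' in [set b' : vertex | column b' = column b /\
     exists t' : tiling, particles t' b' /\
       particles t' `\ b' = particles t `\ b]].

(* Extended-real valued, so as to make sense also when there is no largest or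
   smallest reachable position. *)
Definition nplus (t : tiling) (b : vertex) : \bar R :=
  ereal_sup [set m%:E | m in reachable t b].

Definition nminus (t : tiling) (b : vertex) : \bar R :=
  ereal_inf [set m%:E | m in reachable t b].

(* The positions of vertices in the column of b differ from vpos b by
   integers. *)
Definition available (t : tiling) (b : vertex) : set R :=
  [set m : R | m - vpos b \is a Num.int /\
    (nminus t b <= m%:E <= nplus t b)%E].

Definition particle_at (u : vertex) (t : tiling) : set vertex :=
  [set b | [/\ particles t b, column b = column u
             & (nminus t b <= (vpos u)%:E <= nplus t b)%E]].

Definition X (u : vertex) : set tiling :=
  [set t | exists b, particle_at u t b].

(* The particle b^(u); its value is irrelevant outside X u. *)
Definition bpart (u : vertex) (t : tiling) : vertex := xget u (particle_at u t).

End Particles.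

Arguments reachable R t b : clear implicits.
Arguments available R t b : clear implicits.

(* Main.v *)
Require Import Defs.
From HB Require Import structures.
From mathcomp Require Import all_boot all_order all_algebra.
From mathcomp Require Import finmap.
From mathcomp Require Import all_classical all_reals all_analysis measurable_realfun.
From mathcomp Require Import ring zify.

Set Implicit Arguments.
Unset Strict Implicit.
Unset Printing Implicit Defensive.

Import Order.TTheory GRing.Theory Num.Theory.
Import numFieldNormedType.Exports.

Local Open Scope classical_set_scope.
Local Open Scope ring_scope.

(* Let I = {-i, ..., N - i} be the set of available positions of b. Given the
   other particles, the Gibbs property makes the position -i + j of b uniform in
   I, one hexagon flip at a time; vertical translation invariance makes the place
   of 0 in I uniform as well. Hence P(I, n(b)) depends on N only, and both sides
   reduce to the identity
     1/12 sum_{i, j <= N, j <> i} (N + 2) = N (N + 1) (N + 2) / 12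
                                          = 1/2 sum_{j < i <= N} (N - i + 1).
   The positions reachable by b are those reachable by flips as soon as b has
   particles above and below it in its column, which holds almost surely by
   translation invariance. *)

(** The extremal positions are defined through all tilings with the same other particles, a global
    condition on which the Gibbs property and the sigma-algebra give no direct hold. It is replaced
    by the event [window a k c], a condition on finitely many lozenges: on both sides of the column,
    the faces from position a to the particle are paired downwards, those from the particle to c
    upwards, and each of the two patterns fails to continue on at least one side. Such a failure
    forces a particle in a neighbouring column, and interlacing turns it into a barrier for every
    tiling with the same other particles, provided the column has further particles in both
    directions. The integrands are thus controlled only off a null set, and their measurability
    there is not at hand; their integrals are obtained by sandwiching them between measurable
    functions. No integrability enters: both sides become series of non-negative terms indexed by
    the window length, compared term by term in the extended reals. *)

(** * Faces and lozenges along column 0 *)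

(* On either side s of column 0 (s = true: left), the faces form a strip
   ..., eface s k, oface s k, eface s (k + 1), oface s (k + 1), ...
   ordered downwards: eface s k touches the vertical edge at position k of
   column 0, and oface s k the edge half a step below it in the next column.
   dn s k and up s k are the lozenges pairing eface s k with its lower and its
   upper neighbour; the faces left single belong to particles, mono k in column 0
   and omono s k in the neighbouring column. *)
Definition mono (k : int) : lozenge := ((k, k), type3).
Definition dn (s : bool) (k : int) : lozenge :=
  if s then ((k + 1, k), type2) else ((k, k + 1), type1).
Definition up (s : bool) (k : int) : lozenge :=
  ((k, k), if s then type1 else type2).
Definition omono (s : bool) (k : int) : lozenge :=
  (if s then (k + 1, k) else (k, k + 1), type3).
Definition eface (s : bool) (k : int) : face := ((k, k), s).
Definition oface (s : bool) (k : int) : face :=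
  (if s then (k + 1, k) else (k, k + 1), ~~ s).

Lemma mono_faces k : lozenge_faces (mono k) = [set eface true k; eface false k].
Proof. by rewrite lozenge_facesE. Qed.

Lemma dn_faces s k : lozenge_faces (dn s k) = [set eface s k; oface s k].
Proof.
rewrite /dn /eface /oface; case: s; rewrite lozenge_facesE /=.
  by rewrite setUC; congr [set (_, _); _]; apply/vertexP; rewrite vertexD vertexN /=; lia.
by rewrite setUC; congr [set (_, _); _]; apply/vertexP; rewrite vertexD vertexN /=; lia.
Qed.

Lemma up_faces s k : lozenge_faces (up s k) = [set eface s k; oface s (k - 1)].
Proof.
rewrite /up /eface /oface; case: s; rewrite lozenge_facesE /=;
  by congr [set _; (_, _)]; apply/vertexP; rewrite vertexD vertexN /=; lia.
Qed.

Lemma omono_face s k : lozenge_faces (omono s k) (oface s k).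
Proof. by rewrite /omono lozenge_facesE; case: s; [right|left]. Qed.

Lemma eface_lozenge (l : lozenge) s k : lozenge_faces l (eface s k) ->
  [\/ l = mono k, l = dn s k | l = up s k].
Proof.
case: l => [[x y] d]; rewrite lozenge_facesE /eface /mono /dn /up.
case: d; case: s => -[]; rewrite /= => -[].
all: try (move=> -> -> //; by [constructor 1|constructor 2|constructor 3]).
all: move=> E1 E2; try by [].
all: by constructor 2; congr ((_, _), _); lia.
Qed.

Lemma oface_lozenge (l : lozenge) s k : lozenge_faces l (oface s k) ->
  [\/ l = omono s k, l = dn s k | l = up s (k + 1)].
Proof.
case: l => [[x y] d]; rewrite lozenge_facesE /oface /omono /dn /up.
case: d; case: s => -[]; rewrite /= => -[].
all: move=> E1 E2; try by [].
all: try by constructor 1; congr ((_, _), _); lia.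
all: try by constructor 2; congr ((_, _), _); lia.
all: by constructor 3; congr ((_, _), _); lia.
Qed.

Lemma tiling_ex (t : tiling) (f : face) :
  exists2 l, lozenges t l & lozenge_faces l f.
Proof.
have [cov _ _] := tilingP t.
have : cover (lozenges t) lozenge_faces f by rewrite cov.
by case=> l; exists l.
Qed.

Lemma tiling_uniq (t : tiling) (f : face) (l l' : lozenge) :
  lozenges t l -> lozenges t l' ->
  lozenge_faces l f -> lozenge_faces l' f -> l = l'.
Proof.
move=> tl tl' lf l'f; have [_ triv _] := tilingP t.
by apply: triv => //; exists f.
Qed.

Lemma eface_cover (t : tiling) s k :
  [\/ lozenges t (mono k), lozenges t (dn s k) | lozenges t (up s k)].
Proof.
have [l tl /eface_lozenge [] <-] := tiling_ex t (eface s k);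
  by [constructor 1|constructor 2|constructor 3].
Qed.

Lemma oface_cover (t : tiling) s k :
  [\/ lozenges t (omono s k), lozenges t (dn s k) | lozenges t (up s (k + 1))].
Proof.
have [l tl /oface_lozenge [] <-] := tiling_ex t (oface s k);
  by [constructor 1|constructor 2|constructor 3].
Qed.

Lemma mono_eface s k : lozenge_faces (mono k) (eface s k).
Proof. by rewrite mono_faces; case: s; [left|right]. Qed.

Lemma dn_eface s k : lozenge_faces (dn s k) (eface s k).
Proof. by rewrite dn_faces; left. Qed.

Lemma dn_oface s k : lozenge_faces (dn s k) (oface s k).
Proof. by rewrite dn_faces; right. Qed.

Lemma up_eface s k : lozenge_faces (up s k) (eface s k).
Proof. by rewrite up_faces; left. Qed.

Lemma up_oface s k : lozenge_faces (up s (k + 1)) (oface s k).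
Proof. by rewrite up_faces addrK; right. Qed.

Section Exclusion.
Variables (t : tiling) (s : bool) (k : int).

Lemma mono_dn : lozenges t (mono k) -> lozenges t (dn s k) -> False.
Proof.
move=> t1 t2; have := tiling_uniq t1 t2 (@mono_eface s k) (@dn_eface s k).
by case: s.
Qed.

Lemma mono_up : lozenges t (mono k) -> lozenges t (up s k) -> False.
Proof.
move=> t1 t2; have := tiling_uniq t1 t2 (@mono_eface s k) (@up_eface s k).
by case: s.
Qed.

Lemma dn_up : lozenges t (dn s k) -> lozenges t (up s k) -> False.
Proof.
move=> t1 t2; have := tiling_uniq t1 t2 (@dn_eface s k) (@up_eface s k).
by case: s.
Qed.

Lemma omono_dn : lozenges t (omono s k) -> lozenges t (dn s k) -> False.
Proof.
move=> t1 t2; have := tiling_uniq t1 t2 (@omono_face s k) (@dn_oface s k).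
by case: s.
Qed.

Lemma omono_up : lozenges t (omono s k) -> lozenges t (up s (k + 1)) -> False.
Proof.
move=> t1 t2; have := tiling_uniq t1 t2 (@omono_face s k) (@up_oface s k).
by case: s.
Qed.

Lemma dn_upS : lozenges t (dn s k) -> lozenges t (up s (k + 1)) -> False.
Proof.
move=> t1 t2; have := tiling_uniq t1 t2 (@dn_oface s k) (@up_oface s k).
by case: s.
Qed.

End Exclusion.

(** * Positions of a particle in a column *)

Lemma int_min (Q : int -> Prop) (k : int) : (exists2 i, k < i & Q i) ->
  exists m, [/\ k < m, Q m & forall i, k < i < m -> ~ Q i].
Proof.
move=> [i ki Qi].
have exn : exists n : nat, `[< Q (k + 1 + n%:Z) >].
  by exists (absz (i - k - 1)%R); apply/asboolP; rewrite (_ : _ + _ = i) //; lia.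
case: (ex_minnP exn) => n /asboolP Qn nmin; exists (k + 1 + n%:Z).
split=> // [|j /andP[kj jn] Qj]; first by lia.
have := nmin (absz (j - k - 1)%R); rewrite (_ : k + 1 + _ = j); last by lia.
by move=> /(_ (introT (asboolP _) Qj)); lia.
Qed.

Lemma int_max (Q : int -> Prop) (k : int) : (exists2 i, i < k & Q i) ->
  exists m, [/\ m < k, Q m & forall i, m < i < k -> ~ Q i].
Proof.
move=> [i ik Qi]; have [] := @int_min (fun x => Q (- x)) (- k).
  by exists (- i); rewrite ?opprK //; lia.
move=> m [km Qm mmin]; exists (- m); split=> // [|j mj Qj]; first by lia.
by apply: (mmin (- j)); rewrite ?opprK //; lia.
Qed.

(* Interlacing: consecutive particles in one column are separated by a particle
   in each of the two neighbouring columns. *)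
Lemma mono_gap (t : tiling) s j k : j < k ->
  lozenges t (mono j) -> lozenges t (mono k) ->
  exists2 i, j <= i < k & lozenges t (omono s i).
Proof.
move=> jk tj tk; apply: contrapT => no.
have {}no i : j <= i < k -> ~ lozenges t (omono s i).
  by move=> ik ti; apply: no; exists i.
suff H (n : nat) : j + n%:Z < k -> lozenges t (up s (j + n%:Z + 1)).
  have := H (absz (k - j - 1)%R); rewrite (_ : _ + 1 = k); last by lia.
  by move=> /(_ _)/(mono_up tk); apply; lia.
elim: n => [|n IH] nk.
  case: (oface_cover t s (j + 0%:Z)) => // [|tdn].
    by move/no; case; lia.
  by rewrite addr0 in tdn; case: (mono_dn tj tdn).
case: (oface_cover t s (j + n.+1%:Z)) => // [|tdn].
  by move/no; case; lia.
have /IH : j + n%:Z < k by lia.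
rewrite (_ : j + n%:Z + 1 = j + n.+1%:Z); last by lia.
by move/(dn_up tdn).
Qed.

(** Same propagation, now with [dn] lozenges started by the neighbouring particle at j and blocked
    by the one at k. *)
Lemma omono_gap (t : tiling) s j k : j < k ->
  lozenges t (omono s j) -> lozenges t (omono s k) ->
  exists2 i, j < i <= k & lozenges t (mono i).
Proof.
move=> jk tj tk; apply: contrapT => no.
have {}no i : j < i <= k -> ~ lozenges t (mono i).
  by move=> ik ti; apply: no; exists i.
suff H (n : nat) : j + n%:Z < k -> lozenges t (dn s (j + n%:Z + 1)).
  have := H (absz (k - j - 1)%R); rewrite (_ : _ + 1 = k); last by lia.
  by move=> /(_ _)/(omono_dn tk); apply; lia.
elim: n => [|n IH] nk.
  case: (eface_cover t s (j + 0%:Z + 1)) => // [|tup].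
    by move/no; case; lia.
  by rewrite addr0 in tup; case: (omono_up tj tup).
case: (eface_cover t s (j + n.+1%:Z + 1)) => // [|tup].
  by move/no; case; lia.
have /IH : j + n%:Z < k by lia.
rewrite (_ : j + n%:Z + 1 = j + n.+1%:Z); last by lia.
by move=> /dn_upS /(_ tup).
Qed.

(* The particle at k can be flipped exactly to the positions a, ..., c. *)
Definition window (a k c : int) : set tiling := [set t |
  [/\ lozenges t (mono k),
      forall r s, a <= r < k -> lozenges t (dn s r),
      forall r s, k < r <= c -> lozenges t (up s r),
      ~ (forall s, lozenges t (dn s (a - 1)))
    & ~ (forall s, lozenges t (up s (c + 1)))]].

(** The exceptional set of the whole argument. A column without any particle is not in it: such a
    tiling has no window and lies outside [X], where both integrands vanish. *)
Definition unconfined : set tiling := [set t | exists k,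
  lozenges t (mono k) /\
  ((forall i, k < i -> ~ lozenges t (mono i)) \/
   (forall i, i < k -> ~ lozenges t (mono i)))].

Lemma confined_next (t : tiling) k : ~ unconfined t -> lozenges t (mono k) ->
  exists2 i, k < i & lozenges t (mono i).
Proof.
move=> Ut tk; apply: contrapT => no; apply: Ut; exists k; split=> //; left.
by move=> i ki ti; apply: no; exists i.
Qed.

Lemma confined_prev (t : tiling) k : ~ unconfined t -> lozenges t (mono k) ->
  exists2 i, i < k & lozenges t (mono i).
Proof.
move=> Ut tk; apply: contrapT => no; apply: Ut; exists k; split=> //; right.
by move=> i ki ti; apply: no; exists i.
Qed.

(** The next particle in either direction occupies both faces at its position, so the runs of [up]
    and [dn] lozenges must break before it; a and c are the last positions before the first
    break. *)
Lemma window_ex (t : tiling) k : ~ unconfined t -> lozenges t (mono k) ->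
  exists a c, a <= k <= c /\ window a k c t.
Proof.
move=> Ut tk.
have [m [km Qm mmin]] : exists m, [/\ k < m, ~ (forall s, lozenges t (up s m))
    & forall i, k < i < m -> ~ ~ (forall s, lozenges t (up s i))].
  apply: int_min; have [i ki ti] := confined_next Ut tk.
  by exists i => // /(_ true); apply: mono_up.
have [p [pk Qp pmax]] : exists p, [/\ p < k, ~ (forall s, lozenges t (dn s p))
    & forall i, p < i < k -> ~ ~ (forall s, lozenges t (dn s i))].
  apply: int_max; have [i ki ti] := confined_prev Ut tk.
  by exists i => // /(_ true); apply: mono_dn.
exists (p + 1), (m - 1); split; first by lia.
split=> //; rewrite ?addrK ?subrK //.
- by move=> r s ark; apply: contrapT => no; apply: (pmax r) => [|/(_ s)]; lia || exact: no.
- by move=> r s ark; apply: contrapT => no; apply: (mmin r) => [|/(_ s)]; lia || exact: no.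
Qed.

(** If the particles differed, neither could lie in the window of the other, so the common position
    x would lie above one particle and below the other, carrying both a [dn] and an [up] lozenge.
    Once the particles agree, the maximality of the runs fixes the ends. *)
Lemma window_uniq (t : tiling) a k c a' k' c' (x : int) :
  a <= k <= c -> a' <= k' <= c' -> a <= x <= c -> a' <= x <= c' ->
  window a k c t -> window a' k' c' t -> [/\ a = a', k = k' & c = c'].
Proof.
have keq b l d b' l' d' : b <= l <= d -> b' <= l' <= d' ->
    b <= x <= d -> b' <= x <= d' ->
    window b l d t -> window b' l' d' t -> l <= l'.
  move=> bld b'l'd' bxd b'xd' [tl dl ul _ _] [tl' dl' ul' _ _].
  rewrite leNgt; apply/negP => ll'.
  have d'l : d' < l.
    rewrite ltNge; apply/negP => ld'.
    by apply: (mono_up tl (ul' l true _)); lia.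
  have l'b : l' < b.
    rewrite ltNge; apply/negP => ld'.
    by apply: (mono_dn tl' (dl l' true _)); lia.
  by apply: (dn_up (dl x true _) (ul' x true _)); lia.
have ceq b l d b' d' : b <= l <= d -> b' <= l <= d' ->
    window b l d t -> window b' l d' t -> b' <= b /\ d <= d'.
  move=> bld b'l'd' [tl dl ul nb nd] [tl' dl' ul' nb' nd'].
  split; rewrite leNgt; apply/negP => lt.
    by apply: nb' => s; apply: dl; lia.
  by apply: nd' => s; apply: ul; lia.
move=> akc akc' axc axc' w w'.
have kk' : k = k'.
  apply/eqP; rewrite eq_le (keq _ _ _ _ _ _ akc akc' axc axc' w w').
  by rewrite (keq _ _ _ _ _ _ akc' akc axc' axc w' w).
rewrite -kk' in akc' w' *.
have [? ?] := ceq _ _ _ _ _ akc akc' w w'.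
have [? ?] := ceq _ _ _ _ _ akc' akc w' w.
by split=> //; lia.
Qed.

(** The break at c + 1 forces a neighbouring particle just below c, on some side s. The previous
    particle p of the column forces, on the same side, another one between p and k. Both persist in
    [t'], so by interlacing [t'] has a particle of column 0 between them. If k' were beyond c, this
    would be an unmoved particle of [t] other than the one at k, excluded by the choice of p and by
    the run of [up] lozenges. *)
Lemma window_upper (t t' : tiling) a k c k' : ~ unconfined t ->
  a <= k <= c -> window a k c t ->
  particles t' `\ (k', k') = particles t `\ (k, k) -> k' <= c.
Proof.
move=> Ut akc [tk dk uk na nc] tt'; rewrite leNgt; apply/negP => ck'.
have mt' i : lozenges t' (mono i) -> i <> k' -> lozenges t (mono i) /\ i <> k.
  move=> ti ik'; have : (particles t' `\ (k', k')) (i, i) by split=> // -[].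
  by rewrite tt' => -[? ik]; split=> // ik2; apply: ik; rewrite ik2.
have ot i s : lozenges t (omono s i) -> lozenges t' (omono s i).
  have vk (j : int) : (if s then (i + 1, i) else (i, i + 1)) <> (j, j).
    by case: s => -[]; lia.
  move=> ti; have : (particles t `\ (k, k)) (if s then (i + 1, i) else (i, i + 1)).
    by split=> // /vk.
  by rewrite -tt' => -[].
have [s ns] : exists s, ~ lozenges t (up s (c + 1)).
  by apply/existsNP.
have oc : lozenges t (omono s c).
  case: (oface_cover t s c) => // tdn.
  have [kc|kc] := eqVneq k c; first by rewrite -kc in tdn; case: (mono_dn tk tdn).
  by case: (dn_up tdn (uk _ _ _)); lia.
have [p [pk tp pmax]] := int_max (confined_prev Ut tk).
have [j jpk tj] := mono_gap s pk tp tk.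
have jc : j < c by lia.
have [i ijc ti] := omono_gap jc (ot _ _ tj) (ot _ _ oc).
have [|{}ti ik] := mt' _ ti; first by lia.
have [ki|ik'] := ltP k i; last by apply: (pmax i) => //; lia.
by apply: (mono_up ti (uk i s _)); lia.
Qed.

(** Mirror image of [window_upper]: the barrier is the neighbouring particle at a - 1, and the next
    particle below k plays the role of p. *)
Lemma window_lower (t t' : tiling) a k c k' : ~ unconfined t ->
  a <= k <= c -> window a k c t ->
  particles t' `\ (k', k') = particles t `\ (k, k) -> a <= k'.
Proof.
move=> Ut akc [tk dk uk na nc] tt'; rewrite leNgt; apply/negP => ck'.
have mt' i : lozenges t' (mono i) -> i <> k' -> lozenges t (mono i) /\ i <> k.
  move=> ti ik'; have : (particles t' `\ (k', k')) (i, i) by split=> // -[].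
  by rewrite tt' => -[? ik]; split=> // ik2; apply: ik; rewrite ik2.
have ot i s : lozenges t (omono s i) -> lozenges t' (omono s i).
  have vk (j : int) : (if s then (i + 1, i) else (i, i + 1)) <> (j, j).
    by case: s => -[]; lia.
  move=> ti; have : (particles t `\ (k, k)) (if s then (i + 1, i) else (i, i + 1)).
    by split=> // /vk.
  by rewrite -tt' => -[].
have [s ns] : exists s, ~ lozenges t (dn s (a - 1)).
  by apply/existsNP.
have oa : lozenges t (omono s (a - 1)).
  case: (oface_cover t s (a - 1)) => //; rewrite subrK => tup.
  have [ka|ka] := eqVneq k a; first by rewrite -ka in tup; case: (mono_up tk tup).
  by case: (dn_up (dk _ _ _) tup); lia.
have [p [pk tp pmin]] := int_min (confined_next Ut tk).
have [j jpk tj] := mono_gap s pk tk tp.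
have ja : a - 1 < j by lia.
have [i ija ti] := omono_gap ja (ot _ _ oa) (ot _ _ tj).
have [|{}ti ik] := mt' _ ti; first by lia.
have [ki|ik'] := ltP i k; last by apply: (pmin i) => //; lia.
by apply: (mono_dn ti (dk i s _)); lia.
Qed.

(** * Flips and the Gibbs property *)

Lemma lozenge_faces_neq0 (l : lozenge) : lozenge_faces l !=set0.
Proof.
case: l => u [] ; rewrite lozenge_facesE;
  by [exists (u, true); left | exists (u, false); left].
Qed.

Section Swap.
Variables C C' : set lozenge.
Hypothesis C'triv : trivIset C' lozenge_faces.
Hypothesis coverCC' : cover C lozenge_faces = cover C' lozenge_faces.

(** No remaining lozenge of [t] can overlap [C'], since the faces of [C'] are exactly those taken by
    the removed set [C]. *)
Lemma swap_subproof (t : tiling) : C `<=` lozenges t ->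
  partition ((lozenges t `\` C) `|` C') lozenge_faces [set: face].
Proof.
have mix (l l' : lozenge) f : C `<=` lozenges t -> lozenges t l -> ~ C l ->
    C' l' -> lozenge_faces l f -> lozenge_faces l' f -> False.
  move=> Ct tl Cl C'l' lf l'f.
  have : cover C lozenge_faces f by rewrite coverCC'; exists l'.
  by move=> [m Cm mf]; apply: Cl; rewrite (tiling_uniq tl (Ct _ Cm) lf mf).
move=> Ct; split.
- apply/seteqP; split=> // f _; have [l tl lf] := tiling_ex t f.
  have [Cl|Cl] := pselect (C l); last by exists l => //; left.
  have : cover C' lozenge_faces f by rewrite -coverCC'; exists l.
  by move=> [m Cm mf]; exists m => //; right.
- move=> l l' [[tl Cl]|C'l] [[tl' Cl']|C'l'] [f [lf l'f]].
  + exact: tiling_uniq tl tl' lf l'f.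
  + by case: (mix l l' f).
  + by case: (mix l' l f).
  + by apply: C'triv => //; exists f.
- by move=> l _; apply: lozenge_faces_neq0.
Qed.

Lemma swap_compatible (t : tiling) : C `<=` lozenges t ->
  exists t' : tiling, C' `<=` lozenges t' /\
    lozenges t' `\` inside (cover C lozenge_faces) =
    lozenges t `\` inside (cover C lozenge_faces).
Proof.
move=> Ct; exists (Tiling (swap_subproof Ct)); split=> [l C'l|]; first by right.
apply/seteqP; split=> l /= [].
  move=> [[tl Cl]|C'l] li; split=> //.
  by exfalso; apply: li; rewrite coverCC' => f lf; exists l.
move=> tl li; split=> //; left; split=> // Cl.
by apply: li => f lf; exists l.
Qed.

End Swap.

(** A lozenge inside the region shares a face with a member of [C] and hence equals it; a lozenge
    not inside is prescribed by [t]. *)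
Lemma compatible_unique (C : set lozenge) (t s s' : tiling) :
  compatible (cover C lozenge_faces) t s ->
  compatible (cover C lozenge_faces) t s' ->
  C `<=` lozenges s -> C `<=` lozenges s' -> s = s'.
Proof.
have sub (r r' : tiling) : compatible (cover C lozenge_faces) t r ->
    compatible (cover C lozenge_faces) t r' ->
    C `<=` lozenges r -> C `<=` lozenges r' -> lozenges r `<=` lozenges r'.
  rewrite /compatible /= => tr tr' Cr Cr' l rl.
  have [li|li] := pselect (inside (cover C lozenge_faces) l).
    have [f lf] := lozenge_faces_neq0 l; have [m Cm mf] := li _ lf.
    by rewrite (tiling_uniq rl (Cr _ Cm) lf mf); apply: Cr'.
  have : (lozenges r `\` inside (cover C lozenge_faces)) l by [].
  by rewrite tr -tr' => -[].
move=> ts ts' Cs Cs'; apply: tiling_eq; apply/seteqP; split; exact: sub.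
Qed.

(** Given the lozenges not inside the common region, [C] and [C'] each single out at most one
    compatible tiling, and exchanging one set for the other shows that one tiling exists exactly
    when the other does. The two conditional probabilities therefore agree pointwise. *)
Lemma gibbs_swap (R : realType) (P : probability tilingM R) (C C' : set lozenge)
    (B : set tilingM) :
  gibbs P ->
  trivIset C lozenge_faces -> trivIset C' lozenge_faces ->
  cover C lozenge_faces = cover C' lozenge_faces ->
  finite_set (cover C lozenge_faces) ->
  measurable ([set t : tiling | C `<=` lozenges t] : set tilingM) ->
  measurable ([set t : tiling | C' `<=` lozenges t] : set tilingM) ->
  <<s cylinders (~` inside (cover C lozenge_faces)) >> B ->
  P ([set t : tiling | C `<=` lozenges t] `&` B) =
  P ([set t : tiling | C' `<=` lozenges t] `&` B).
Proof.
move=> gP trC trC' CC' fD mC mC' mB.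
rewrite (gP _ fD _ mC _ mB) (gP _ fD _ mC' _ mB).
apply: eq_integral => t _; congr (_%:E); rewrite /uniform_compatible.
congr (_%:R / _).
set D := cover C lozenge_faces in fD mB *.
(* Uniqueness reduces the cardinality to 0 or 1, that is, to the truth value of an existence
   statement. *)
have one (E : set lozenge) : cover E lozenge_faces = D ->
    #|` fset_set (compatible D t `&` [set t : tiling | E `<=` lozenges t])| =
    `[< exists s : tiling, compatible D t s /\ E `<=` lozenges s >].
  move=> ED; case: (asboolP (exists s : tiling, _)) => [[s [ts Es]]|no].
    rewrite (_ : _ `&` _ = [set s]) ?fset_set1 ?cardfs1 //.
    apply/seteqP; split=> [r [tr Er]|r -> //].
    by rewrite -ED in ts tr; apply: (compatible_unique tr ts).
  rewrite (_ : _ `&` _ = set0) ?fset_set0 ?cardfs0 //.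
  by apply/seteqP; split=> // s [ts Es]; apply: no; exists s.
rewrite !one //; congr (nat_of_bool _); apply: asbool_equiv_eq; split=> -[s [ts Es]].
  have [s' [Es' ss']] := swap_compatible trC' CC' Es.
  by exists s'; split=> //; rewrite /compatible /= ss'.
have [s' [Es' ss']] := swap_compatible trC (esym CC') Es.
by exists s'; split=> //; rewrite /compatible /= /D CC' ss' -CC'.
Qed.

(** * Flips of a hexagon *)

(** The six faces around the vertex [(k + 1, k + 1)]. Replacing its tiling [hex_high k] by
    [hex_low k] is the elementary flip moving a particle from k to k + 1. *)
Definition hexagon (k : int) : set face :=
  [set f | exists s, [\/ f = eface s k, f = eface s (k + 1) | f = oface s k]].

Definition hex_high (k : int) : set lozenge :=
  [set l | l = mono k \/ exists s, l = up s (k + 1)].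

Definition hex_low (k : int) : set lozenge :=
  [set l | l = mono (k + 1) \/ exists s, l = dn s k].

Lemma cover_hex_high k : cover (hex_high k) lozenge_faces = hexagon k.
Proof.
apply/seteqP; split=> [f [l [->|[s ->]]]|f [s []] ->].
- by rewrite mono_faces => -[] ->; [exists true|exists false]; constructor 1.
- rewrite up_faces addrK => -[] ->; exists s; by [constructor 2|constructor 3].
- by exists (mono k); [left|exact: mono_eface].
- by exists (up s (k + 1)); [right; exists s|exact: up_eface].
- by exists (up s (k + 1)); [right; exists s|exact: up_oface].
Qed.

Lemma cover_hex_low k : cover (hex_low k) lozenge_faces = hexagon k.
Proof.
apply/seteqP; split=> [f [l [->|[s ->]]]|f [s []] ->].
- by rewrite mono_faces => -[] ->; [exists true|exists false]; constructor 2.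
- rewrite dn_faces => -[] ->; exists s; by [constructor 1|constructor 3].
- by exists (dn s k); [right; exists s|exact: dn_eface].
- by exists (mono (k + 1)); [left|exact: mono_eface].
- by exists (dn s k); [right; exists s|exact: dn_oface].
Qed.

Lemma trivIset_hex_high k : trivIset (hex_high k) lozenge_faces.
Proof.
move=> l l' [->|[s ->]] [->|[s' ->]] // [f []]; rewrite ?mono_faces ?up_faces.
- by rewrite /oface addrK; case: s' => -[] -> [] []; lia.
- by rewrite /oface addrK; case: s => -[] -> [] []; lia.
- rewrite /eface /oface addrK; case: s; case: s' => // -[] -> [] [] //=; lia.
Qed.

Lemma trivIset_hex_low k : trivIset (hex_low k) lozenge_faces.
Proof.
move=> l l' [->|[s ->]] [->|[s' ->]] // [f []]; rewrite ?mono_faces ?dn_faces.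
- by rewrite /oface; case: s' => -[] -> [] []; lia.
- by rewrite /oface; case: s => -[] -> [] []; lia.
- rewrite /eface /oface; case: s; case: s' => // -[] -> [] [] //=; lia.
Qed.

Lemma finite_hexagon k : finite_set (hexagon k).
Proof.
pose r := [:: eface true k; eface true (k + 1); oface true k;
              eface false k; eface false (k + 1); oface false k].
apply: (@sub_finite_set _ _ [set` r]) => [f [s []] -> /=|]; last exact: finite_seq.
all: by rewrite !inE; case: s; rewrite eqxx ?orbT.
Qed.

(** What [window a k c] and [window a (k + 1) c] have in common once the lozenges in the hexagon at
    k are removed. For a <= k < c all rows mentioned avoid k and k + 1, so the event is determined
    by lozenges not inside the hexagon, as conditioning requires. *)
Definition outer_rows (a k c : int) : set tiling := [set t |
  [/\ forall r s, a <= r < k -> lozenges t (dn s r),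
      forall r s, k + 1 < r <= c -> lozenges t (up s r),
      ~ (forall s, lozenges t (dn s (a - 1)))
    & ~ (forall s, lozenges t (up s (c + 1)))]].

Lemma window_high a k c : k < c ->
  window a k c = [set t | hex_high k `<=` lozenges t] `&` outer_rows a k c.
Proof.
move=> kc; apply/seteqP; split=> t.
- move=> [tk da uc na nc]; split.
    by move=> l [->|[s ->]] //; apply: uc; lia.
  by split=> // r s rk; apply: uc; lia.
- move=> [kt [da uc na nc]]; split=> //; first by apply: kt; left.
  move=> r s rk; have [->|rk1] := eqVneq r (k + 1); last by apply: uc; lia.
  by apply: kt; right; exists s.
Qed.

Lemma window_low a k c : a <= k ->
  window a (k + 1) c = [set t | hex_low k `<=` lozenges t] `&` outer_rows a k c.
Proof.
move=> ak; apply/seteqP; split=> t.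
- move=> [tk da uc na nc]; split.
    by move=> l [->|[s ->]] //; apply: da; lia.
  by split=> // r s rk; apply: da; lia.
- move=> [kt [da uc na nc]]; split=> //; first by apply: kt; left.
  move=> r s rk; have [->|rk1] := eqVneq r k; last by apply: da; lia.
  by apply: kt; right; exists s.
Qed.

Lemma eface_outside s r k : r <> k -> r <> k + 1 -> ~ hexagon k (eface s r).
Proof.
by move=> rk rk1 [s' []]; rewrite /eface /oface; case: s'; case=> //; lia.
Qed.

Lemma dn_outside s r k : r <> k -> r <> k + 1 -> ~ inside (hexagon k) (dn s r).
Proof. by move=> rk rk1 /(_ _ (@dn_eface s r)); apply: eface_outside. Qed.

Lemma up_outside s r k : r <> k -> r <> k + 1 -> ~ inside (hexagon k) (up s r).
Proof. by move=> rk rk1 /(_ _ (@up_eface s r)); apply: eface_outside. Qed.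

Lemma particle_outside (v : vertex) k : v <> (k, k) -> v <> (k + 1, k + 1) ->
  ~ inside (hexagon k) (v, type3).
Proof.
move=> vk vk1 vin.
have vf b : lozenge_faces (v, type3) (v, b).
  by case: v {vk vk1 vin} => x y; rewrite lozenge_facesE; case: b; [left|right].
case: (vin _ (vf true)) => s [/(congr1 fst)/vk|/(congr1 fst)/vk1|] //.
case: (vin _ (vf false)) => s' [/(congr1 fst)/vk|/(congr1 fst)/vk1|] //.
by rewrite /oface; case: s'; case: s => // -[->] [] //; lia.
Qed.

Lemma outer_rows_outside (t t' : tiling) a k c : a <= k < c ->
  lozenges t' `\` inside (hexagon k) = lozenges t `\` inside (hexagon k) ->
  outer_rows a k c t -> outer_rows a k c t'.
Proof.
move=> akc tt' [da uc na nc].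
have same l : ~ inside (hexagon k) l -> lozenges t' l <-> lozenges t l.
  move=> lo; split=> tl.
    by have [] : (lozenges t `\` inside (hexagon k)) l by rewrite -tt'.
  by have [] : (lozenges t' `\` inside (hexagon k)) l by rewrite tt'.
split.
- by move=> r s rk; apply/same; [apply: dn_outside; lia|apply: da].
- by move=> r s rk; apply/same; [apply: up_outside; lia|apply: uc].
- by move=> dt; apply: na => s; apply/same; [apply: dn_outside; lia|apply: dt].
- by move=> ut; apply: nc => s; apply/same; [apply: up_outside; lia|apply: ut].
Qed.

Lemma flip_down (t : tiling) a k c : a <= k < c -> window a k c t ->
  exists t' : tiling, window a (k + 1) c t' /\
    particles t' `\ (k + 1, k + 1) = particles t `\ (k, k).
Proof.
move=> akc; rewrite window_high; last by lia.
move=> [hk ot]; have [] := swap_compatible (@trivIset_hex_low k) _ hk.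
  by rewrite cover_hex_high cover_hex_low.
rewrite cover_hex_high => t' [lk tt']; exists t'; split.
  by rewrite window_low; [split=> //; exact: outer_rows_outside tt' ot|lia].
apply/seteqP; split=> v [tv vk].
- have vk' : v <> (k, k).
    move=> vk'; apply: (@mono_dn t' true k); last by apply: lk; right; exists true.
    by rewrite /mono -vk'.
  suff [] : (lozenges t `\` inside (hexagon k)) (v, type3) by [].
  by rewrite -tt'; split=> //; exact: particle_outside.
- have vk' : v <> (k + 1, k + 1).
    move=> vk'; apply: (@mono_up t true (k + 1)); last by apply: hk; right; exists true.
    by rewrite /mono -vk'.
  suff [] : (lozenges t' `\` inside (hexagon k)) (v, type3) by [].
  by rewrite tt'; split=> //; exact: particle_outside.
Qed.

Lemma flip_up (t : tiling) a k c : a <= k < c -> window a (k + 1) c t ->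
  exists t' : tiling, window a k c t' /\
    particles t' `\ (k, k) = particles t `\ (k + 1, k + 1).
Proof.
move=> akc; rewrite window_low; last by lia.
move=> [lk ot]; have [] := swap_compatible (@trivIset_hex_high k) _ lk.
  by rewrite cover_hex_high cover_hex_low.
rewrite cover_hex_low => t' [hk tt']; exists t'; split.
  by rewrite window_high; [split=> //; exact: outer_rows_outside tt' ot|lia].
apply/seteqP; split=> v [tv vk].
- have vk' : v <> (k + 1, k + 1).
    move=> vk'; apply: (@mono_up t' true (k + 1)); last by apply: hk; right; exists true.
    by rewrite /mono -vk'.
  suff [] : (lozenges t `\` inside (hexagon k)) (v, type3) by [].
  by rewrite -tt'; split=> //; exact: particle_outside.
- have vk' : v <> (k, k).
    move=> vk'; apply: (@mono_dn t true k); last by apply: lk; right; exists true.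
    by rewrite /mono -vk'.
  suff [] : (lozenges t' `\` inside (hexagon k)) (v, type3) by [].
  by rewrite tt'; split=> //; exact: particle_outside.
Qed.

Lemma window_bottom (t : tiling) a k c : a <= k <= c -> window a k c t ->
  exists t' : tiling, lozenges t' (mono c) /\
    particles t' `\ (c, c) = particles t `\ (k, k).
Proof.
move=> akc; have [n cE] : exists n : nat, c = k + n%:Z.
  by exists (absz (c - k)%R); lia.
elim: n t k akc cE => [|n IH] t k akc cE.
  by rewrite cE addr0 => -[tk _ _ _ _]; exists t.
move=> w; have [|t1 [w1 t1t]] := flip_down _ w; first by lia.
have [||t' [tc t't1]] := IH _ _ _ _ w1; [by lia|by lia|].
by exists t'; split=> //; rewrite t't1.
Qed.

Lemma window_top (t : tiling) a k c : a <= k <= c -> window a k c t ->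
  exists t' : tiling, lozenges t' (mono a) /\
    particles t' `\ (a, a) = particles t `\ (k, k).
Proof.
move=> akc; have [n aE] : exists n : nat, k = a + n%:Z.
  by exists (absz (k - a)%R); lia.
elim: n t k akc aE => [|n IH] t k akc aE.
  by rewrite aE addr0 => -[tk _ _ _ _]; exists t.
rewrite -(subrK 1 k) => w; have [|t1 [w1 t1t]] := flip_up _ w; first by lia.
have [||t' [tc t't1]] := IH _ _ _ _ w1; [by lia|by lia|].
by exists t'; split=> //; rewrite t't1.
Qed.

(** * Extremal positions read off a window *)

Section Positions.
Variable R : realType.

Lemma column0 (v : vertex) : column v = 0 -> v = (v.1, v.1).
Proof. by case: v => x y; rewrite /column /= => /subr0_eq ->. Qed.

Lemma vpos_diag (k : int) : vpos R (k, k) = k%:~R.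
Proof. by rewrite /vpos /= intrD; field. Qed.

Lemma reachable_window (t : tiling) a k c (m : R) : ~ unconfined t ->
  a <= k <= c -> window a k c t -> reachable R t (k, k) m ->
  a%:~R <= m <= c%:~R.
Proof.
move=> Ut akc w [v [vk [t' [tv tt']]] <-].
have vE : v = (v.1, v.1) by apply: column0; rewrite vk /column subrr.
rewrite vE in tt' *; rewrite vpos_diag !ler_int.
by rewrite (window_lower Ut akc w tt') (window_upper Ut akc w tt').
Qed.

Lemma nplus_window (t : tiling) a k c : ~ unconfined t ->
  a <= k <= c -> window a k c t -> nplus R t (k, k) = (c%:~R)%:E.
Proof.
move=> Ut akc w; apply/eqP; rewrite eq_le; apply/andP; split.
  apply: ge_ereal_sup => _ [m /(reachable_window Ut akc w)/andP[_ mc] <-].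
  by rewrite lee_fin.
have [t' [tc tt']] := window_bottom akc w.
apply: ereal_sup_ubound; exists c%:~R => //.
exists (c, c); last exact: vpos_diag.
by split; [rewrite /column !subrr|exists t'].
Qed.

Lemma nminus_window (t : tiling) a k c : ~ unconfined t ->
  a <= k <= c -> window a k c t -> nminus R t (k, k) = (a%:~R)%:E.
Proof.
move=> Ut akc w; apply/eqP; rewrite eq_le; apply/andP; split.
  have [t' [ta tt']] := window_top akc w.
  apply: ereal_inf_lbound; exists a%:~R => //.
  exists (a, a); last exact: vpos_diag.
  by split; [rewrite /column !subrr|exists t'].
apply: le_ereal_inf_tmp => _ [m /(reachable_window Ut akc w)/andP[am _] <-].
by rewrite lee_fin.
Qed.

Lemma particle_at_window (t : tiling) a k c : ~ unconfined t ->
  a <= k <= c -> window a k c t -> a <= 0 <= c -> particle_at R 0 t (k, k).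
Proof.
move=> Ut akc w ac; split; [by case: w|by rewrite /column !subrr|].
rewrite (nplus_window Ut akc w) (nminus_window Ut akc w) vpos_diag !lee_fin.
by rewrite !ler_int.
Qed.

Lemma window_particle_at (t : tiling) v : ~ unconfined t ->
  particle_at R 0 t v -> exists a k c,
    [/\ v = (k, k), a <= k <= c, a <= 0 <= c & window a k c t].
Proof.
move=> Ut [tv v0 vac]; have vE := column0 v0; rewrite vE in tv vac.
have [a [c [akc w]]] := window_ex Ut tv; exists a, v.1, c; split=> //.
move: vac; rewrite (nplus_window Ut akc w) (nminus_window Ut akc w) vpos_diag.
by rewrite !lee_fin !ler_int.
Qed.

(** The choice made by [bpart] is forced, because windows containing 0 are unique. *)
Lemma bpart_window (t : tiling) a k c : ~ unconfined t ->
  a <= k <= c -> window a k c t -> a <= 0 <= c -> bpart R 0 t = (k, k).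
Proof.
move=> Ut akc w ac; rewrite /bpart; case: xgetP => [v -> tv|/(_ (k, k))]; last first.
  by case; exact: particle_at_window ac.
have [a' [k' [c' [-> akc' ac' w']]]] := window_particle_at Ut tv.
by have [_ -> _] := window_uniq akc' akc ac' ac w' w.
Qed.

Lemma available_window (t : tiling) a k c : ~ unconfined t ->
  a <= k <= c -> window a k c t ->
  available R t (k, k) = [set i%:~R | i in [set i : int | a <= i <= c]].
Proof.
move=> Ut akc w; apply/seteqP; split=> [m|_ [i /= ic <-]]; rewrite /available /=.
  rewrite (nplus_window Ut akc w) (nminus_window Ut akc w) vpos_diag !lee_fin.
  move=> [/intrP[i mi]]; rewrite (_ : m = (i + k)%:~R).
    by rewrite !ler_int => iac; exists (i + k).
  by rewrite intrD -mi subrK.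
rewrite (nplus_window Ut akc w) (nminus_window Ut akc w) vpos_diag !lee_fin.
by rewrite !ler_int -intrB; split=> //; apply: intr_int.
Qed.

Lemma counting_available (t : tiling) a k c : ~ unconfined t ->
  a <= k <= c -> window a k c t ->
  counting (available R t (k, k)) = ((c - a + 1)%:~R)%:E :> \bar R.
Proof.
move=> Ut akc w; rewrite (available_window Ut akc w).
set A := (X in counting X).
have cA : (A #= `I_(absz (c - a + 1)%R))%card.
  rewrite (_ : A = (fun n : nat => (a + n%:Z)%:~R : R) @` `I_(absz (c - a + 1)%R)).
    by apply: inj_card_eq => n m _ _ /intr_inj /addrI [].
  apply/seteqP; split=> [_ [i /= iac <-]|_ [n /= nac <-]].
    by exists (absz (i - a)%R) => /=; [lia|congr (_%:~R); lia].
  by exists (a + n%:Z) => //=; lia.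
rewrite /counting asboolT; last by exists (absz (c - a + 1)%R).
by rewrite (card_fset_set cA) pmulrn; congr (_%:~R%:E); lia.
Qed.

End Positions.

(** * Probabilities of windows *)

Section Measurability.
Context d (T : measurableType d).

Lemma measurable_forall (I : countType) (F : I -> set T) :
  (forall i, measurable (F i)) -> measurable [set t | forall i, F i t].
Proof.
move=> mF; rewrite (_ : [set t | _] = ~` \bigcup_i ~` F i).
  apply: measurableC; apply: countable_bigcupT_measurable => [|i].
    exact: countableP.
  exact: measurableC.
apply/seteqP; split=> t /= H; first by case=> i _; apply; apply: H.
by move=> i; apply: contrapT => Fi; apply: H; exists i.
Qed.

Lemma measurable_imply (Q : Prop) (A : set T) :
  (Q -> measurable A) -> measurable [set t | Q -> A t].
Proof.
have [q|nq] := pselect Q => mA.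
  rewrite (_ : [set t | _] = A); first exact: mA.
  by apply/seteqP; split=> t /= H; [apply: H|].
rewrite (_ : [set t | _] = setT); first exact: measurableT.
by apply/seteqP; split=> // t _ /nq.
Qed.

End Measurability.

Section Cylinders.
Variable K : set lozenge.
Notation tilingK := (g_sigma_algebraType (cylinders K)).

Lemma measurable_cylinder l : K l ->
  measurable ([set t : tiling | lozenges t l] : set tilingK).
Proof. by move=> Kl; apply: sub_sigma_algebra; exists l. Qed.

(** Stated for the sigma-algebra generated by an arbitrary family [K] of lozenges, because [gibbs]
    conditions on the one generated by the lozenges not inside the hexagon. *)
Lemma measurable_outer_rows a k c : a <= k < c ->
  (forall s r, r <> k -> r <> k + 1 -> K (dn s r)) ->
  (forall s r, r <> k -> r <> k + 1 -> K (up s r)) ->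
  measurable (outer_rows a k c : set tilingK).
Proof.
move=> akc Kdn Kup.
pose A1 : set tilingK :=
  [set t : tiling | forall r s, a <= r < k -> lozenges t (dn s r)].
pose A2 : set tilingK :=
  [set t : tiling | forall r s, k + 1 < r <= c -> lozenges t (up s r)].
pose A3 : set tilingK := [set t : tiling | forall s, lozenges t (dn s (a - 1))].
pose A4 : set tilingK := [set t : tiling | forall s, lozenges t (up s (c + 1))].
have -> : outer_rows a k c = A1 `&` A2 `&` ~` A3 `&` ~` A4.
  by apply/seteqP; split=> t [] // [[]].
have m1 : measurable A1.
  do 2![apply: measurable_forall => ?]; apply: measurable_imply => ?.
  by apply: measurable_cylinder; apply: Kdn; lia.
have m2 : measurable A2.
  do 2![apply: measurable_forall => ?]; apply: measurable_imply => ?.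
  by apply: measurable_cylinder; apply: Kup; lia.
have m3 : measurable A3.
  by apply: measurable_forall => ?; apply: measurable_cylinder; apply: Kdn; lia.
have m4 : measurable A4.
  by apply: measurable_forall => ?; apply: measurable_cylinder; apply: Kup; lia.
do 2![apply: measurableI; last exact: measurableC].
exact: measurableI.
Qed.

End Cylinders.

Lemma measurable_hex_high k :
  measurable ([set t : tiling | hex_high k `<=` lozenges t] : set tilingM).
Proof.
rewrite (_ : [set t : tiling | _] = [set t : tiling | lozenges t (mono k)] `&`
    [set t : tiling | forall s, lozenges t (up s (k + 1))]).
  apply: measurableI; first exact: measurable_cylinder.
  by apply: measurable_forall => s; exact: measurable_cylinder.
apply/seteqP; split=> t /=.
  by move=> kt; split=> [|s]; apply: kt; [left|right; exists s].
by move=> [tk tup] l [->|[s ->]].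
Qed.

Lemma measurable_hex_low k :
  measurable ([set t : tiling | hex_low k `<=` lozenges t] : set tilingM).
Proof.
rewrite (_ : [set t : tiling | _] = [set t : tiling | lozenges t (mono (k + 1))] `&`
    [set t : tiling | forall s, lozenges t (dn s k)]).
  apply: measurableI; first exact: measurable_cylinder.
  by apply: measurable_forall => s; exact: measurable_cylinder.
apply/seteqP; split=> t /=.
  by move=> kt; split=> [|s]; apply: kt; [left|right; exists s].
by move=> [tk tdn] l [->|[s ->]].
Qed.

Lemma measurable_window a k c : measurable (window a k c : set tilingM).
Proof.
pose A0 : set tilingM := [set t : tiling | lozenges t (mono k)].
pose A1 : set tilingM :=
  [set t : tiling | forall r s, a <= r < k -> lozenges t (dn s r)].
pose A2 : set tilingM :=
  [set t : tiling | forall r s, k < r <= c -> lozenges t (up s r)].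
pose A3 : set tilingM := [set t : tiling | forall s, lozenges t (dn s (a - 1))].
pose A4 : set tilingM := [set t : tiling | forall s, lozenges t (up s (c + 1))].
have -> : window a k c = A0 `&` A1 `&` A2 `&` ~` A3 `&` ~` A4.
  by apply/seteqP; split=> t [] // [[[]]].
have mc l := @measurable_cylinder setT l I.
do 2![apply: measurableI; last
  by apply: measurableC; apply: measurable_forall => ?; exact: mc].
apply: measurableI; last first.
  by do 2![apply: measurable_forall => ?]; apply: measurable_imply => ?; exact: mc.
apply: measurableI; first exact: mc.
by do 2![apply: measurable_forall => ?]; apply: measurable_imply => ?; exact: mc.
Qed.

Section Translation.
Variables (t : tiling) (m : int).

Lemma translate_mono r :
  lozenges (translate (m, m) t) (mono r) = lozenges t (mono (r - m)).
Proof. by []. Qed.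

Lemma translate_dn s r :
  lozenges (translate (m, m) t) (dn s r) = lozenges t (dn s (r - m)).
Proof.
rewrite /dn /=; case: s; congr (lozenges t (_, _));
  by apply/vertexP; rewrite vertexD vertexN /=; lia.
Qed.

Lemma translate_up s r :
  lozenges (translate (m, m) t) (up s r) = lozenges t (up s (r - m)).
Proof. by []. Qed.

End Translation.

Lemma translate_window m a k c :
  translate (m, m) @^-1` window a k c = window (a - m) (k - m) (c - m).
Proof.
apply/seteqP; split=> t -[tk da uc na nc]; split=> //.
- move=> r s rk; have := da (r + m) s; rewrite translate_dn addrK; apply; lia.
- by move=> r s rk; have := uc (r + m) s; rewrite translate_up addrK; apply; lia.
- move=> dt; apply: na => s; rewrite translate_dn (_ : _ - _ - _ = a - m - 1) //; lia.
- move=> ut; apply: nc => s; rewrite translate_up (_ : _ + _ - _ = c - m + 1) //; lia.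
- by move=> r s rk; rewrite translate_dn; apply: da; lia.
- by move=> r s rk; rewrite translate_up; apply: uc; lia.
- move=> dt; apply: na => s; have := dt s.
  by rewrite translate_dn (_ : a - 1 - m = a - m - 1) //; lia.
- move=> ut; apply: nc => s; have := ut s.
  by rewrite translate_up (_ : c + 1 - m = c - m + 1) //; lia.
Qed.

(** * Equal probabilities and null events *)

Section Invariance.
Variables (R : realType) (P : probability tilingM R).
Hypotheses (invP : translation_invariant P) (gibbsP : gibbs P).

Lemma probability_flip a k c : a <= k < c ->
  P (window a k c) = P (window a (k + 1) c).
Proof.
move=> akc; rewrite window_high ?window_low; try lia.
apply: (gibbs_swap gibbsP).
- exact: trivIset_hex_high.
- exact: trivIset_hex_low.
- by rewrite cover_hex_high cover_hex_low.
- by rewrite cover_hex_high; exact: finite_hexagon.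
- exact: measurable_hex_high.
- exact: measurable_hex_low.
- rewrite cover_hex_high; apply: (@measurable_outer_rows (~` inside (hexagon k))) => //.
  + by move=> s r rk rk1; exact: dn_outside.
  + by move=> s r rk rk1; exact: up_outside.
Qed.

Lemma probability_window (a : int) (j N : nat) : (j <= N)%N ->
  P (window a (a + j%:Z) (a + N%:Z)) = P (window 0 0 N%:Z).
Proof.
move=> jN; transitivity (P (window a a (a + N%:Z))).
  elim: j jN => [|j IH] jN; first by rewrite addr0.
  rewrite -IH; last by lia.
  rewrite (_ : a + j.+1%:Z = a + j%:Z + 1); last by lia.
  by symmetry; apply: probability_flip; lia.
have := invP (a, a) (measurable_window a a (a + N%:Z)).
by rewrite translate_window subrr (addrC a) addrK.
Qed.

(* Infinitely many disjoint events of equal probability are null. *)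
Lemma translates_null (A : int -> set tilingM) :
  (forall m, measurable (A m)) -> trivIset setT A ->
  (forall m, translate (m, m) @^-1` A m = A 0) -> forall m, P (A m) = 0%E.
Proof.
move=> mA tA trA m.
have PA i : P (A i) = P (A 0) by rewrite -(invP (i, i) (mA i)) trA.
rewrite PA; have [x Ax] : exists x : R, P (A 0) = x%:E.
  by exists (fine (P (A 0))); rewrite fineK // fin_num_measure.
have x0 : 0 <= x by rewrite -lee_fin -Ax.
rewrite Ax; congr (_%:E); apply/eqP; rewrite eq_le x0 andbT leNgt; apply/negP => xp.
have nx n : x *+ n <= 1.
  rewrite -lee_fin; have := @probability_le1 _ _ _ P (\big[setU/set0]_(i < n) A i%:Z).
  rewrite measure_bigsetU_ord //.
    rewrite (eq_bigr (fun _ => x%:E)) => [|i _]; last by rewrite -Ax; exact: PA.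
    rewrite sumEFin sumr_const card_ord; apply.
    by apply: bigsetU_measurable.
  by apply/trivIsetP => i j _ _ ij; move/trivIsetP: tA; apply => //; apply: contra ij => /eqP[/val_inj ->].
have := nx (Num.truncn x^-1).+1; rewrite leNgt => /negP; apply.
rewrite -mulr_natr -ltr_pdivrMl // mulr1.
by apply: real_truncnS_gt; apply: num_real.
Qed.

(** Positions grow downwards, so the lowest particle is the one with the largest index. *)
Definition lowest (m : int) : set tilingM := [set t : tiling |
  lozenges t (mono m) /\ forall i, m < i -> ~ lozenges t (mono i)].
Definition highest (m : int) : set tilingM := [set t : tiling |
  lozenges t (mono m) /\ forall i, i < m -> ~ lozenges t (mono i)].

Lemma measurable_lowest m : measurable (lowest m).
Proof.
apply: measurableI; first exact: measurable_cylinder.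
apply: measurable_forall => i; apply: measurable_imply => _.
by apply: measurableC; exact: measurable_cylinder.
Qed.

Lemma measurable_highest m : measurable (highest m).
Proof.
apply: measurableI; first exact: measurable_cylinder.
apply: measurable_forall => i; apply: measurable_imply => _.
by apply: measurableC; exact: measurable_cylinder.
Qed.

(** A column has at most one lowest particle, so these events are disjoint for different m, while
    vertical translations carry them into one another. *)
Lemma lowest_null m : P (lowest m) = 0%E.
Proof.
apply: translates_null m => [m||m]; first exact: measurable_lowest.
  move=> i j _ _ [t [[ti iN] [tj jN]]].
  by case: (ltgtP i j) => // [/iN|/jN].
apply/seteqP; split=> t -[tm mN]; split=> [|i mi].
- by rewrite -(subrr m).
- have : ~ lozenges t (mono (i + m - m)) by apply: mN; lia.
  by rewrite addrK.
- by rewrite translate_mono subrr.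
- by rewrite translate_mono; apply: mN; lia.
Qed.

Lemma highest_null m : P (highest m) = 0%E.
Proof.
apply: translates_null m => [m||m]; first exact: measurable_highest.
  move=> i j _ _ [t [[ti iN] [tj jN]]].
  by case: (ltgtP i j) => // [/jN|/iN].
apply/seteqP; split=> t -[tm mN]; split=> [|i mi].
- by rewrite -(subrr m).
- have : ~ lozenges t (mono (i + m - m)) by apply: mN; lia.
  by rewrite addrK.
- by rewrite translate_mono subrr.
- by rewrite translate_mono; apply: mN; lia.
Qed.

Lemma unconfinedE : unconfined =
  \bigcup_(n : nat) ((lowest n%:Z `|` lowest (- n%:Z)) `|`
                     (highest n%:Z `|` highest (- n%:Z))).
Proof.
apply/seteqP; split=> t; last first.
  by move=> [n _ [[|]|[|]] [tn nN]]; eexists; split; eauto.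
move=> [k [tk H]].
have [n [kn|kn]] : exists n : nat, k = n%:Z \/ k = - n%:Z.
  by exists (absz k); lia.
all: rewrite {}kn in tk H; exists n => //.
  by case: H => H; [left; left|right; left].
by case: H => H; [left; right|right; right].
Qed.

Lemma measurable_unconfined : measurable (unconfined : set tilingM).
Proof.
rewrite unconfinedE; apply: bigcupT_measurable => n.
by do 2!apply: measurableU;
  first [exact: measurable_lowest|exact: measurable_highest].
Qed.

Lemma unconfined_null : P unconfined = 0%E.
Proof.
apply/(negligibleP _ measurable_unconfined); rewrite unconfinedE.
apply: negligible_bigcup => n; do 2!apply: negligibleU.
- by apply/negligibleP; [exact: measurable_lowest|exact: lowest_null].
- by apply/negligibleP; [exact: measurable_lowest|exact: lowest_null].
- by apply/negligibleP; [exact: measurable_highest|exact: highest_null].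
- by apply/negligibleP; [exact: measurable_highest|exact: highest_null].
Qed.

End Invariance.

(** * Integration over windows *)

Section NullModification.
Local Open Scope ereal_scope.
Context d (T : measurableType d) (R : realType).
Variable mu : {measure set T -> \bar R}.

(** The integral of a non-negative function is a supremum over the simple functions below it, which
    is monotone whether or not the function is measurable. *)
Lemma ge0_le_integral_nonmeasurable (f g : T -> \bar R) :
  (forall x, 0 <= f x) -> (forall x, f x <= g x) ->
  \int[mu]_x f x <= \int[mu]_x g x.
Proof.
move=> f0 fg; have g0 x : 0 <= g x by exact: le_trans (fg x).
rewrite !ge0_integralTE //; apply: ereal_sup_le => _ [h hf <-].
by exists h => // x; apply: le_trans (hf x) (fg x).
Qed.

Lemma ge0_integral_off_null (f g : T -> \bar R) (N : set T) :
  measurable N -> mu N = 0 -> measurable_fun setT g ->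
  (forall x, 0 <= f x) -> (forall x, 0 <= g x) ->
  (forall x, ~ N x -> f x = g x) ->
  \int[mu]_x f x = \int[mu]_x g x.
Proof.
move=> mN N0 mg f0 g0 fg.
have mNC : measurable (~` N) by exact: measurableC.
(* [f] lies between [g1], which is 0 on [N], and [g2], which is infinite on [N]; both are measurable
   and almost everywhere equal to [g]. *)
pose g1 := g \_ (~` N).
pose g2 := fun x => g x + (cst +oo \_ N) x.
have mg1 : measurable_fun setT g1.
  by apply/(measurable_restrictT _ mNC); exact: measurable_funTS.
have mg2 : measurable_fun setT g2.
  apply: emeasurable_funD => //; apply/(measurable_restrictT _ mN).
  exact: measurable_cst.
have g10 x : 0 <= g1 x by rewrite /g1 patchE; case: ifP.
have oo0 x : 0 <= (cst +oo \_ N) x :> \bar R.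
  by rewrite patchE; case: ifP => // _; exact: leey.
have g20 x : 0 <= g2 x by exact: adde_ge0.
have g1E : \int[mu]_x g1 x = \int[mu]_x g x.
  apply: ge0_ae_eq_integral => //; exists N; split=> // x /= H.
  apply: contrapT => Nx; apply: H => _; rewrite /g1 patchE mem_set //.
have g2E : \int[mu]_x g2 x = \int[mu]_x g x.
  apply: ge0_ae_eq_integral => //; exists N; split=> // x /= H.
  apply: contrapT => Nx; apply: H => _; rewrite /g2 patchE memNset ?adde0 //.
apply/eqP; rewrite eq_le; apply/andP; split.
  rewrite -g2E; apply: ge0_le_integral_nonmeasurable => // x.
  rewrite /g2 patchE; case: ifPn => [_|/negP xN].
    by rewrite addey ?leey // gt_eqF // (lt_le_trans _ (g0 x)).
  by rewrite adde0 fg // => Nx; apply: xN; exact: mem_set.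
rewrite -g1E; apply: ge0_le_integral_nonmeasurable => // x.
rewrite /g1 patchE; case: ifPn => // xN.
by rewrite fg //; exact: set_mem xN.
Qed.

End NullModification.

Section WindowIntegral.
Local Open Scope ereal_scope.
Variables (R : realType) (P : probability tilingM R).
Hypotheses (invP : translation_invariant P) (gibbsP : gibbs P).

(* The window of length N + 1 whose top is i above 0, with the particle j below
   the top. *)
Definition window0 (N i j : nat) : set tilingM :=
  window (- i%:Z) (- i%:Z + j%:Z) (- i%:Z + N%:Z).

Lemma measurable_window0 N i j : measurable (window0 N i j).
Proof. exact: measurable_window. Qed.

Lemma window0_uniq t N i j N' i' j' :
  (i <= N)%N -> (j <= N)%N -> (i' <= N')%N -> (j' <= N')%N ->
  window0 N i j t -> window0 N' i' j' t -> [/\ N = N', i = i' & j = j'].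
Proof.
move=> iN jN iN' jN' w w'.
have [||||] := window_uniq (x := 0%R) _ _ _ _ w w'; try lia.
by move=> ? ? ?; split; lia.
Qed.

(** The step function with value [w N i j] on [window0 N i j], over windows of N + 1 positions
    containing 0. The weights are natural numbers, so that the final comparison is an identity in
    [nat]. *)
Definition window_sum (w : nat -> nat -> nat -> nat) (N : nat) (t : tilingM) :=
  \sum_(i < N.+1) \sum_(j < N.+1)
    ((w N i j)%:R%:E * (\1_(window0 N i j) t)%:E : \bar R).

Lemma window_sum_ge0 w N t : 0 <= window_sum w N t.
Proof. by do 2![apply: sume_ge0 => ? _]; rewrite mule_ge0 ?lee_fin. Qed.

Lemma measurable_window_term w N i j :
  measurable_fun setT (fun t : tilingM =>
    (w N i j)%:R%:E * (\1_(window0 N i j) t)%:E : \bar R).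
Proof.
apply: measurable_funeM; apply/measurable_EFinP.
exact: measurable_indic (measurable_window0 _ _ _).
Qed.

Lemma measurable_window_sum w N : measurable_fun setT (window_sum w N).
Proof. by do 2![apply: emeasurable_sum => ?]; exact: measurable_window_term. Qed.

Lemma window_sum_in w N i j t : (i <= N)%N -> (j <= N)%N ->
  window0 N i j t -> \sum_(M <oo) window_sum w M t = (w N i j)%:R%:E.
Proof.
move=> iN jN wt.
have ind M (k l : 'I_M.+1) : \1_(window0 M k l) t =
    [&& M == N, k == i :> nat & l == j :> nat]%:R :> R.
  rewrite indicE; congr (nat_of_bool _)%:R; apply/idP/idP; rewrite inE.
    move=> wt'; have [] := window0_uniq _ _ iN jN wt' wt; try by rewrite -ltnS.
    by move=> MN ki lj; rewrite ki lj MN !eqxx.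
  by move=> /and3P[/eqP MN /eqP ki /eqP lj]; rewrite ki lj MN.
rewrite (nneseriesD1 (n := N)) //; last by move=> *; exact: window_sum_ge0.
rewrite eseries0 ?adde0 => [|M _ /= MN]; last first.
  apply: big1 => k _; apply: big1 => l _.
  by rewrite ind (negbTE MN) mule0.
have iN1 : (i < N.+1)%N by []. have jN1 : (j < N.+1)%N by [].
rewrite /window_sum (bigD1 (Ordinal iN1)) //= (bigD1 (Ordinal jN1)) //=.
rewrite !big1 ?adde0.
- by rewrite (ind N (Ordinal iN1) (Ordinal jN1)) /= !eqxx mule1.
- move=> k ki; apply: big1 => l _; rewrite ind.
  by rewrite -(inj_eq val_inj) /= in ki; rewrite (negbTE ki) andbF mule0.
- move=> l lj; rewrite (ind N (Ordinal iN1)).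
  by rewrite -(inj_eq val_inj) /= in lj; rewrite (negbTE lj) !andbF mule0.
Qed.

Lemma window_sum_out w t : ~ unconfined t -> ~ X R 0%R t ->
  \sum_(M <oo) window_sum w M t = 0.
Proof.
move=> Ut Xt; apply: eseries0 => M _ _; apply: big1 => i _; apply: big1 => j _.
rewrite indicE memNset ?mule0 // => wt; apply: Xt.
have := ltn_ord i; have := ltn_ord j => jM iM.
by eexists; apply: (particle_at_window _ Ut _ wt); lia.
Qed.

Lemma X_window0 t : ~ unconfined t -> X R 0%R t ->
  exists N i j, [/\ (i <= N)%N, (j <= N)%N & window0 N i j t].
Proof.
move=> Ut [v /(window_particle_at Ut)[a [k [c [_ akc ac w]]]]].
(* Since a <= 0, [absz a] is the distance from the top of the window down to 0. *)
exists (absz (c - a)%R), (absz a), (absz (k - a)%R); split; [lia|lia|].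
rewrite /window0; suff [-> -> ->] : [/\ (- (absz a)%:Z = a)%R,
  (a + (absz (k - a)%R)%:Z = k)%R & (a + (absz (c - a)%R)%:Z = c)%R] by [].
by split; lia.
Qed.

(** Off [unconfined], [f] equals the measurable series of the [window_sum w N]. Non-negativity
    allows integrating it term by term, and [probability_window] makes each probability independent
    of i and j, so that it factors out of the double sum of weights. *)
Lemma integral_window (w : nat -> nat -> nat -> nat) (f : tilingM -> \bar R) :
  (forall t, 0 <= f t) -> (forall t, ~ X R 0%R t -> f t = 0) ->
  (forall t N i j, ~ unconfined t -> (i <= N)%N -> (j <= N)%N ->
     window0 N i j t -> f t = (w N i j)%:R%:E) ->
  \int[P]_t f t = \sum_(N <oo)
    (\sum_(i < N.+1) \sum_(j < N.+1) w N i j)%:R%:E * P (window 0 0 N%:Z).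
Proof.
move=> f0 fX fw.
rewrite (ge0_integral_off_null (measurable_unconfined) (unconfined_null invP)
  (g := fun t => \sum_(N <oo) window_sum w N t)) //; first last.
- move=> t Ut; have [Xt|Xt] := pselect (X R 0%R t); last first.
    by rewrite window_sum_out // fX.
  have [N [i [j [iN jN wt]]]] := X_window0 Ut Xt.
  by rewrite (window_sum_in _ iN jN wt); exact: fw wt.
- by move=> t; apply: nneseries_ge0 => N _ _; exact: window_sum_ge0.
- have := @ge0_emeasurable_sum _ tilingM R setT (window_sum w) xpredT.
  by apply=> [N t _ _|N _]; [exact: window_sum_ge0|exact: measurable_window_sum].
rewrite integral_nneseries //; first last.
- by move=> N t _; exact: window_sum_ge0.
- by move=> N; exact: measurable_window_sum.
apply: eq_eseriesr => N _; rewrite ge0_integral_sum //; first last.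
- by move=> i t _; apply: sume_ge0 => j _; rewrite mule_ge0 ?lee_fin.
- by move=> i; apply: emeasurable_sum => j; exact: measurable_window_term.
rewrite natr_sum -sumEFin ge0_sume_distrl; last by move=> i _; rewrite lee_fin.
apply: eq_bigr => i _; rewrite ge0_integral_sum //; last first.
  by move=> j; exact: measurable_window_term.
rewrite natr_sum -sumEFin ge0_sume_distrl; last by move=> j _; rewrite lee_fin.
apply: eq_bigr => j _; rewrite ge0_integralZl ?lee_fin //; first last.
  by apply/measurable_EFinP; exact: measurable_indic (measurable_window0 _ _ _).
rewrite integral_indic //; last exact: measurable_window0.
rewrite setIT; congr (_ * _).
by apply: (probability_window invP gibbsP); rewrite -ltnS.
Qed.

End WindowIntegral.

(** * Weight sums and the final identity *)

Lemma sum_nat_neq (N i : nat) : (i <= N)%N ->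
  (\sum_(j < N.+1) (j != i :> nat) = N)%N.
Proof.
move=> iN; have iN1 : (i < N.+1)%N by [].
rewrite (eq_bigr (fun j : 'I_N.+1 => if j != Ordinal iN1 then 1 else 0)%N) => [|j _].
  by rewrite -big_mkcond sum1_card (cardC1 (Ordinal iN1)) card_ord.
by rewrite -(inj_eq val_inj) /=; case: eqP.
Qed.

Lemma sum_nat_lt (N i : nat) : (i <= N)%N ->
  (\sum_(j < N.+1) (j < i)%N = i)%N.
Proof.
elim: N => [|N IH] iN; first by rewrite big_ord_recr big_ord0; case: i iN.
rewrite big_ord_recr /=; case: (ltngtP i N.+1) iN => // [iN _|-> _].
  by rewrite IH // addn0.
rewrite (eq_bigr (fun=> 1%N)) => [|j _]; last by rewrite ltn_ord.
by rewrite sum_nat_const card_ord ?ltnn; lia.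
Qed.

Lemma sum_weight_displaced (N : nat) :
  (\sum_(i < N.+1) \sum_(j < N.+1) (N.+2 * (j != i :> nat)) =
   N * N.+1 * N.+2)%N.
Proof.
rewrite (eq_bigr (fun=> N.+2 * N)%N) => [|i _].
  by rewrite sum_nat_const card_ord; lia.
by rewrite -big_distrr /= sum_nat_neq // -ltnS.
Qed.

Lemma sum_weight_above (N : nat) :
  (6 * \sum_(i < N.+1) \sum_(j < N.+1) ((N - i).+1 * (j < i)) =
   N * N.+1 * N.+2)%N.
Proof.
rewrite (eq_bigr (fun i : 'I_N.+1 => (N - i).+1 * i)%N) => [|i _]; last first.
  by rewrite -big_distrr /= sum_nat_lt // -ltnS.
(* The summand is (N + 1) i - i^2; the sum of squares is kept on the left to avoid truncated
   subtraction, and the upper limit n is separated from [N] to allow induction. *)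
have H n : (n <= N)%N ->
    (6 * \sum_(i < n.+1) ((N - i).+1 * i) + n * n.+1 * (n + n.+1) =
     3 * N.+1 * (n * n.+1))%N.
  elim: n => [|n IH] nN; first by rewrite big_ord_recr big_ord0 /=; lia.
  rewrite big_ord_recr /=; move: IH => /(_ (ltnW nN)).
  move: (\sum_(_ < _) _)%N => x IH.
  have [e Ne] : exists e, N = (n.+1 + e)%N by exists (N - n.+1)%N; lia.
  by move: IH; rewrite Ne addKn; lia.
by have := H N (leqnn N); move: (\sum_(_ < _) _)%N => x; lia.
Qed.

Theorem theorem11 (R : realType) (rho1 rho2 : R)
  (hrho1 : 0 < rho1) (hrho2 : 0 < rho2) (hrho : rho1 + rho2 < 1)
  (P : probability tilingM R) (hP : ergodic_gibbs_measure P rho1 rho2) :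
  let b := bpart R 0 in
  let n := fun t : tilingM => vpos R (b t) in
  ((12^-1 : R)%:E *
     \int[P]_t ((counting (available R t (b t)) + 1) *
                (\1_(X R 0) t)%:E * (\1_[set t | n t != 0] t)%:E)
   = (2^-1 : R)%:E *
     \int[P]_t ((nplus R t (b t) + 1) *
                (\1_(X R 0) t)%:E * (\1_[set t | n t < 0] t)%:E))%E.
Proof.
move=> b n; have [invP _ gibbsP _] := hP.
have windowP t N i j : (i <= N)%N -> (j <= N)%N -> window0 N i j t ->
    [/\ - i%:Z <= - i%:Z + j%:Z <= - i%:Z + N%:Z & - i%:Z <= 0 <= - i%:Z + N%:Z].
  by split; lia.
have bE t N i j : ~ unconfined t -> (i <= N)%N -> (j <= N)%N ->
    window0 N i j t -> b t = (- i%:Z + j%:Z, - i%:Z + j%:Z).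
  move=> Ut iN jN wt; have [kN zN] := windowP _ _ _ _ iN jN wt.
  exact: bpart_window wt zN.
have XE t N i j : ~ unconfined t -> (i <= N)%N -> (j <= N)%N ->
    window0 N i j t -> \1_(X R 0) t = 1 :> R.
  move=> Ut iN jN wt; have [kN zN] := windowP _ _ _ _ iN jN wt.
  by rewrite indicE mem_set //; eexists; exact: particle_at_window wt zN.
have X0 t : ~ X R 0 t -> \1_(X R 0) t = 0 :> R by move=> Xt; rewrite indicE memNset.
(* A window of N + 1 positions gives |I| + 1 = N + 2, and the particle, at -i + j, is away from 0
   exactly when j differs from i. *)
rewrite (integral_window invP gibbsP
  (w := fun N i j => (N.+2 * (j != i :> nat))%N)); first last.
- move=> t N i j Ut iN jN wt; have [kN zN] := windowP _ _ _ _ iN jN wt.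
  rewrite (XE _ _ _ _ Ut iN jN wt) mule1 indicE.
  rewrite (bE _ _ _ _ Ut iN jN wt) (counting_available _ Ut kN wt).
  rewrite -EFinD -EFinM natrM; congr (_ * _)%:E.
    by rewrite pmulrn -[1]/(1%:~R) -intrD; congr (_%:~R); lia.
  congr (nat_of_bool _)%:R.
  transitivity (n t != 0); first by apply/idP/idP; rewrite inE.
  rewrite /n (bE _ _ _ _ Ut iN jN wt) vpos_diag intr_eq0.
  by apply/idP/idP; lia.
- by move=> t Xt; rewrite X0 // mule0 mul0e.
- move=> t; do 2![apply: mule_ge0; last by rewrite lee_fin].
  exact: adde_ge0.
(* The lower end of the window is N - i, hence the weight N - i + 1; the particle is at a negative
   position exactly when j < i. *)
rewrite (integral_window invP gibbsP
  (w := fun N i j => ((N - i).+1 * (j < i))%N)); first last.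
- move=> t N i j Ut iN jN wt; have [kN zN] := windowP _ _ _ _ iN jN wt.
  rewrite (XE _ _ _ _ Ut iN jN wt) mule1 indicE.
  rewrite (bE _ _ _ _ Ut iN jN wt) (nplus_window _ Ut kN wt).
  rewrite -EFinD -EFinM natrM; congr (_ * _)%:E.
    by rewrite pmulrn -[1]/(1%:~R) -intrD; congr (_%:~R); lia.
  congr (nat_of_bool _)%:R.
  transitivity (n t < 0); first by apply/idP/idP; rewrite inE.
  rewrite /n (bE _ _ _ _ Ut iN jN wt) vpos_diag ltrz0.
  by apply/idP/idP; lia.
- by move=> t Xt; rewrite X0 // mule0 mul0e.
(* Non-negativity of [nplus] comes from [X]: there [particle_at] places 0 at or above the largest
   position. Elsewhere the indicator vanishes. *)
- move=> t; have [Xt|Xt] := pselect (X R 0 t); last by rewrite X0 // mule0 mul0e.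
  do 2![apply: mule_ge0; last by rewrite lee_fin].
  apply: adde_ge0 => //.
  have [v tv] := Xt; have : particle_at R 0 t (b t).
    by rewrite /b /bpart; case: xgetP => [w -> //|/(_ v)].
  by move=> [_ _ /andP[_]]; rewrite (_ : vpos R 0 = 0) // /vpos /= mul0r.
rewrite -!nneseriesZl; try by move=> N _; rewrite mule_ge0 ?lee_fin.
apply: eq_eseriesr => N _; rewrite !muleA -!EFinM; congr (_%:E * _)%E.
(* The factor 6 in [sum_weight_above] is the ratio of 1/2 to 1/12. *)
rewrite sum_weight_displaced -sum_weight_above natrM.
by move: (\sum_(_ < _) _)%N => x; field.
Qed.
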